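(* Let $R$ be a subring of $\mathbb{Q}$ and let $n\ge 1$ be an integer. Let $G$ be a group of type $R\text{-}FP_{n+1}$ and suppose $\mathrm{cd}_R(G)=n+1$. Let $H\leq G$ be a subgroup of type $R\text{-}FP_{n+1}$. Then \[ FV_{H,R}^{n+1}\preceq FV_{G,R}^{n+1}.\]
   Context: Rings have an identity. $R$ is a subring of $\mathbb{Q}$ normed by the absolute value. $\mathrm{cd}_R(G)$ is the minimal length of a projective resolution of the trivial $RG$-module $R$. A group $G$ is of type $R\text{-}FP_{m}$ if the trivial $RG$-module $R$ admits a partial projective resolution $P_m\to\cdots\to P_1\to P_0\to R\to 0$ (exact) with each $P_i$ a finitely generated projective $RG$-module. Norms. The group ring $RG$ carries the $\ell_1$-norm $|\sum_g r_g g| = \sum_g |r_g|$. A free $RG$-module $F$ with fixed basis $\Lambda$ carries the $\ell_1$-norm $\|\sum_{x\in\Lambda} a_x x\|_1=\sum_{x\in\Lambda}|a_x|$. A filling norm on a finitely generated $RG$-module $M$ is a function of the form $\|m\|_M=\inf\{\|x\|_1 : x\in F,\ \rho(x)=m\}$, where $\rho\colon F\to M$ is a surjective $RG$-morphism from a finitely generated free $RG$-module $F$ with fixed finite basis. Integral part. An integral part of a finitely generated $RG$-module $P$ is a $\mathbb{Z}G$-submodule $A\subseteq P$ that is finitely generated as a $\mathbb{Z}G$-module and generates $P$ as an $RG$-module. Filling function. Let $G$ be of type $R\text{-}FP_{n+1}$. Choose a partial projective resolution $P_{n+1}\xrightarrow{\partial_{n+1}}P_n\xrightarrow{\partial_n}\cdots\xrightarrow{\partial_1}P_0\to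 R\to 0$ of the trivial $RG$-module $R$ by finitely generated projective $RG$-modules, an integral part $K_n$ of $\ker(\partial_n)$, and filling norms $\|\cdot\|_{P_n}$, $\|\cdot\|_{P_{n+1}}$ on $P_n$, $P_{n+1}$. Then $FV_{G,R}^{n+1}\colon\mathbb{N}\to[0,\infty]$ is \[FV_{G,R}^{n+1}(k)=\sup\{\|\gamma\|_{\partial_{n+1}} : \gamma\in K_n,\ \|\gamma\|_{P_n}\le k\},\qquad \|\gamma\|_{\partial_{n+1}}=\inf\{\|\mu\|_{P_{n+1}} : \mu\in P_{n+1},\ \partial_{n+1}(\mu)=\gamma\},\] with the supremum of the empty set being $0$. $FV_{H,R}^{n+1}$ is defined in the same way with $H$ in place of $G$. These functions depend on the choices made; the claim is meant for any choices. Order. For non-decreasing functions $f,g\colon\mathbb{N}\to[0,\infty]$, $f\preceq g$ means that there is $C>0$ (taken to be an integer, so that $g(Ck+C)$ makes sense) such that $f(k)\le C\,g(Ck+C)+Ck+C$ for all $k\in\mathbb{N}$. *)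

(* Defs.v *)
From HB Require Import structures.
From mathcomp Require Import all_boot all_order all_algebra finmap.
From mathcomp.multinomials Require Import monalg.
From mathcomp Require Import all_classical reals ereal.

Set Implicit Arguments.
Unset Strict Implicit.
Unset Printing Implicit Defensive.

Import Order.TTheory GRing.Theory Num.Theory.

Local Open Scope classical_set_scope.
Local Open Scope ring_scope.

(* The library only makes [{malg R[K]}] a ring when [K] is a [monomType], whose
   axioms (xy = 1 implies x = y = 1) exclude nontrivial groups: only its
   additive structure is reused, on an alias carrying the convolution product. *)
Definition grpring (R : nzRingType) (G : groupType) : predArgType := {malg R[G]}.

HB.instance Definition _ (R : nzRingType) (G : groupType) :=
  GRing.Zmodule.copy (grpring R G) {malg R[G]}.

Section GroupRing.
Context (R : nzRingType) (G : groupType).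
Implicit Types a b c : grpring R G.

Definition gr_one : grpring R G := << 1 *g 1%g >>.

Definition gr_mul a b : grpring R G :=
  \sum_(g <- msupp a) \sum_(h <- msupp b) << a@_g * b@_h *g (g * h)%g >>.

Lemma gr_mulw (d1 d2 : {fset G}) a b :
  (msupp a `<=` d1)%fset -> (msupp b `<=` d2)%fset ->
  gr_mul a b =
    \sum_(g <- d1) \sum_(h <- d2) (<< a@_g * b@_h *g (g * h)%g >> : grpring R G).
Proof.
move=> le_d1 le_d2; rewrite /gr_mul (big_fset_incl _ le_d1) /=.
  apply/eq_bigr=> g _; apply/big_fset_incl => // h _ /mcoeff_outdom ->.
  by rewrite mulr0 monalgU0.
move=> g _ /mcoeff_outdom ag.
by rewrite big1 // => h _; rewrite ag mul0r monalgU0.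
Qed.

Lemma gr_mul0g : left_zero 0 gr_mul.
Proof. by move=> a; rewrite /gr_mul msupp0 big_seq_fset0. Qed.

Lemma gr_mulg0 : right_zero 0 gr_mul.
Proof.
by move=> a; rewrite /gr_mul big1 // => g _; rewrite msupp0 big_seq_fset0.
Qed.

Lemma gr_mulUg (x : R) (g : G) a :
  gr_mul << x *g g >> a = \sum_(h <- msupp a) << x * a@_h *g (g * h)%g >>.
Proof.
rewrite (gr_mulw msuppU_le (fsubset_refl _)) big_seq_fset1.
by apply/eq_bigr => h _; rewrite mcoeffUU.
Qed.

Lemma gr_mulgU (x : R) (g : G) a :
  gr_mul a << x *g g >> = \sum_(h <- msupp a) << a@_h * x *g (h * g)%g >>.
Proof.
rewrite (gr_mulw (fsubset_refl _) msuppU_le).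
by apply/eq_bigr => h _; rewrite big_seq_fset1 mcoeffUU.
Qed.

Lemma gr_mulUU (x y : R) (g h : G) :
  gr_mul << x *g g >> << y *g h >> = << x * y *g (g * h)%g >>.
Proof. by rewrite (gr_mulw msuppU_le msuppU_le) !big_seq_fset1 !mcoeffUU. Qed.

Lemma gr_mulDl : left_distributive gr_mul +%R.
Proof.
move=> a b c.
rewrite [gr_mul a c](gr_mulw (fsubsetUl _ (msupp b)) (fsubset_refl _)).
rewrite [gr_mul b c](gr_mulw (fsubsetUr (msupp a) _) (fsubset_refl _)).
rewrite (gr_mulw (msuppD_le _ _) (fsubset_refl _)).
rewrite -big_split /=; apply/eq_bigr=> g _.
rewrite -big_split /=; apply/eq_bigr=> h _.
by rewrite mcoeffD mulrDl monalgUD.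
Qed.

Lemma gr_mulDr : right_distributive gr_mul +%R.
Proof.
move=> c a b.
rewrite [gr_mul c a](gr_mulw (fsubset_refl _) (fsubsetUl _ (msupp b))).
rewrite [gr_mul c b](gr_mulw (fsubset_refl _) (fsubsetUr (msupp a) _)).
rewrite (gr_mulw (fsubset_refl _) (msuppD_le _ _)).
rewrite -big_split /=; apply/eq_bigr=> g _.
rewrite -big_split /=; apply/eq_bigr=> h _.
by rewrite mcoeffD mulrDr monalgUD.
Qed.

Lemma gr_mul1g : left_id gr_one gr_mul.
Proof.
move=> a; rewrite gr_mulUg [RHS]monalgE.
by apply/eq_bigr=> g _; rewrite mul1r mul1g.
Qed.

Lemma gr_mulg1 : right_id gr_one gr_mul.
Proof.
move=> a; rewrite gr_mulgU [RHS]monalgE.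
by apply/eq_bigr=> g _; rewrite mulr1 mulg1.
Qed.

Lemma gr_mulEl a b :
  gr_mul a b = \sum_(g <- msupp a) gr_mul << a@_g *g g >> b.
Proof. by apply/eq_bigr=> g _; rewrite gr_mulUg. Qed.

Lemma gr_mulEr a b :
  gr_mul a b = \sum_(h <- msupp b) gr_mul a << b@_h *g h >>.
Proof.
by rewrite {1}/gr_mul exchange_big; apply/eq_bigr=> h _; rewrite gr_mulgU.
Qed.

Lemma gr_mulA : associative gr_mul.
Proof.
move=> a b c.
rewrite [RHS](big_morph (gr_mul^~ c) (fun _ _ => gr_mulDl _ _ _) (gr_mul0g _)).
rewrite gr_mulEl; apply/eq_bigr=> g _.
rewrite [LHS](big_morph (gr_mul _) (fun _ _ => gr_mulDr _ _ _) (gr_mulg0 _)).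
rewrite [RHS](big_morph (gr_mul^~ c) (fun _ _ => gr_mulDl _ _ _) (gr_mul0g _)).
apply/eq_bigr=> h _.
rewrite [LHS](big_morph (gr_mul _) (fun _ _ => gr_mulDr _ _ _) (gr_mulg0 _)).
by rewrite gr_mulEr; apply/eq_bigr=> k _; rewrite !gr_mulUU mulrA mulgA.
Qed.

Lemma gr_one_neq0 : gr_one != 0.
Proof. by rewrite monalgU_eq0 oner_eq0. Qed.

HB.instance Definition _ := GRing.Zmodule_isNzRing.Build (grpring R G)
  gr_mulA gr_mul1g gr_mulg1 gr_mulDl gr_mulDr gr_one_neq0.

End GroupRing.

Section GroupRingMaps.
Context (R : nzRingType) (G : groupType).

Definition gr_aug (a : grpring R G) : R := \sum_(g <- msupp a) a@_g.

Lemma gr_augw (d : {fset G}) (a : grpring R G) :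
  (msupp a `<=` d)%fset -> gr_aug a = \sum_(g <- d) a@_g.
Proof. by move=> le_d; apply: big_fset_incl => // g _ /mcoeff_outdom. Qed.

Lemma gr_augU (x : R) (g : G) : gr_aug << x *g g >> = x.
Proof. by rewrite (gr_augw msuppU_le) big_seq_fset1 mcoeffUU. Qed.

Lemma gr_aug_is_zmod_morphism : zmod_morphism gr_aug.
Proof.
move=> a b; rewrite (gr_augw (msuppB_le a b)).
rewrite (gr_augw (fsubsetUl (msupp a) (msupp b))).
rewrite (gr_augw (fsubsetUr (msupp a) (msupp b))) -sumrB.
by apply/eq_bigr => g _; rewrite mcoeffB.
Qed.

HB.instance Definition _ :=
  GRing.isZmodMorphism.Build (grpring R G) R gr_aug gr_aug_is_zmod_morphism.

Lemma gr_aug_is_monoid_morphism : monoid_morphism gr_aug.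
Proof.
split=> [|a b]; first exact: gr_augU.
rewrite raddf_sum mulr_suml; apply/eq_bigr => g _.
rewrite raddf_sum mulr_sumr; apply/eq_bigr => h _.
exact: gr_augU.
Qed.

HB.instance Definition _ :=
  GRing.isMonoidMorphism.Build (grpring R G) R gr_aug gr_aug_is_monoid_morphism.

(* Change of coefficients along the unique ring morphism from Z to R. *)
Definition gr_of_int (a : grpring int G) : grpring R G :=
  \sum_(g <- msupp a) << (a@_g)%:~R *g g >>.

Lemma gr_of_intE (a : grpring int G) (g : G) :
  (gr_of_int a)@_g = (a@_g)%:~R.
Proof.
rewrite raddf_sum /= [in RHS](monalgE a) raddf_sum rmorph_sum /=.
by apply/eq_bigr=> h _; rewrite !mcoeffU; case: eqP.
Qed.

Lemma gr_of_intU (z : int) (g : G) : gr_of_int << z *g g >> = << z%:~R *g g >>.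
Proof. by apply/malgP => h; rewrite gr_of_intE !mcoeffU; case: eqP. Qed.

Lemma gr_of_int_is_zmod_morphism : zmod_morphism gr_of_int.
Proof.
by move=> a b; apply/malgP => g; rewrite mcoeffB !gr_of_intE mcoeffB rmorphB.
Qed.

HB.instance Definition _ :=
  GRing.isZmodMorphism.Build (grpring int G) (grpring R G) gr_of_int
    gr_of_int_is_zmod_morphism.

Lemma gr_of_int_is_monoid_morphism : monoid_morphism gr_of_int.
Proof.
split=> [|a b]; first exact: gr_of_intU.
rewrite [a * b]/(gr_mul a b) raddf_sum /= mulr_suml; apply/eq_bigr => g _.
rewrite raddf_sum /= mulr_sumr; apply/eq_bigr => h _.
by rewrite gr_of_intU intrM; exact/esym/gr_mulUU.
Qed.

HB.instance Definition _ :=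
  GRing.isMonoidMorphism.Build (grpring int G) (grpring R G) gr_of_int
    gr_of_int_is_monoid_morphism.

End GroupRingMaps.

(* The trivial RG-module R. *)
Definition trivmod (R : nzRingType) (G : groupType) : Type := R.

HB.instance Definition _ (R : nzRingType) (G : groupType) :=
  GRing.Zmodule.copy (trivmod R G) R.

Section TrivialModule.
Context (R : nzRingType) (G : groupType).

Definition triv_scale (a : grpring R G) (r : trivmod R G) : trivmod R G :=
  gr_aug a * (r : R).

Lemma triv_scaleA a b r : triv_scale a (triv_scale b r) = triv_scale (a * b) r.
Proof. by rewrite /triv_scale rmorphM mulrA. Qed.

Lemma triv_scale1 : left_id 1 triv_scale.
Proof. by move=> r; rewrite /triv_scale rmorph1 mul1r. Qed.

Lemma triv_scaleDr : right_distributive triv_scale +%R.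
Proof. by move=> a r s; rewrite /triv_scale mulrDr. Qed.

Lemma triv_scaleDl r : {morph triv_scale^~ r : a b / a + b}.
Proof. by move=> a b; rewrite /triv_scale rmorphD mulrDl. Qed.

HB.instance Definition _ :=
  GRing.Zmodule_isLmodule.Build (grpring R G) (trivmod R G)
    triv_scaleA triv_scale1 triv_scaleDr triv_scaleDl.

End TrivialModule.

Section Modules.
Context (A : nzRingType).

Definition projective (P : lmodType A) : Prop :=
  forall (M N : lmodType A) (f : {linear M -> N}) (g : {linear P -> N}),
    (forall y, exists x, f x = y) ->
    exists h : {linear P -> M}, forall x, f (h x) = g x.

Definition fin_gen (M : lmodType A) : Prop :=
  exists (m : nat) (e : 'I_m -> M),
    forall x, exists c : 'I_m -> A, x = \sum_i c i *: e i.

Definition lspan (M : lmodType A) (B : set M) : set M :=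
  [set x | exists (m : nat) (c : 'I_m -> A) (e : 'I_m -> M),
     (forall i, B (e i)) /\ x = \sum_i c i *: e i].

(* ... -> term 1 -> term 0 -> M. The boundary [bd i] is d_(i+1); a partial
   resolution stopping in degree m uses only the terms of degree at most m, and
   nothing is required of the other ones. *)
Record augcomplex (M : lmodType A) := AugComplex {
  term : nat -> lmodType A;
  bd : forall i, {linear term i.+1 -> term i};
  augmap : {linear term 0%N -> M}
}.

(* The kernel of d_i, where d_0 is the augmentation. *)
Definition cycles (M : lmodType A) (C : augcomplex M) (i : nat) :
    set (term C i) :=
  match i return set (term C i) with
  | 0%N => [set x | augmap C x = 0]
  | j.+1 => [set x | bd C j x = 0]
  end.
#[global] Arguments cycles [M] C i.

(* Exactness of term m -> ... -> term 0 -> M -> 0; nothing is said about the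
   kernel of d_m. *)
Definition exact_upto (M : lmodType A) (C : augcomplex M) (m : nat) : Prop :=
  (forall y, exists x, augmap C x = y) /\
  forall i, (i < m)%N -> cycles C i = range (bd C i).

Definition fg_partial_projres (M : lmodType A) (C : augcomplex M) (m : nat) :
    Prop :=
  exact_upto C m /\
  forall i, (i <= m)%N -> projective (term C i) /\ fin_gen (term C i).

Definition projres_length (M : lmodType A) (C : augcomplex M) (d : nat) :
    Prop :=
  [/\ forall m, exact_upto C m,
      forall i, projective (term C i) &
      forall i, (d < i)%N -> forall x : term C i, x = 0].

End Modules.

Definition type_FP (R : nzRingType) (G : groupType) (m : nat) : Prop :=
  exists C : augcomplex (trivmod R G), fg_partial_projres C m.

Definition cd_eq (R : nzRingType) (G : groupType) (d : nat) : Prop :=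
  (exists C : augcomplex (trivmod R G), projres_length C d) /\
  forall (d' : nat) (C : augcomplex (trivmod R G)),
    projres_length C d' -> (d <= d')%N.

Section IntegralPart.
Context (R : nzRingType) (G : groupType) (P : lmodType (grpring R G)).

Definition ZG_submodule (B : set P) : Prop :=
  [/\ B 0, forall x y, B x -> B y -> B (x + y) &
      forall (a : grpring int G) x, B x -> B (gr_of_int R a *: x)].

Definition ZG_fin_gen (B : set P) : Prop :=
  exists (m : nat) (e : 'I_m -> P), (forall i, B (e i)) /\
    forall x, B x ->
      exists c : 'I_m -> grpring int G, x = \sum_i gr_of_int R (c i) *: e i.

(* [M] stands for an RG-submodule of [P]. *)
Definition integral_part (M B : set P) : Prop :=
  [/\ B `<=` M, ZG_submodule B, ZG_fin_gen B & lspan B = M].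

End IntegralPart.

(* A subring R of the rationals is a [subNzRingType Q] for [Q : {pred rat}];
   [val] is its inclusion into [rat]. *)
Section Filling.
Context (K : realType) (Q : {pred rat}) (R : subNzRingType Q).

Definition gr_l1 (G : groupType) (a : grpring R G) : rat :=
  \sum_(g <- msupp a) `|val a@_g|.

Definition free_l1 (G : groupType) (m : nat) (x : 'rV[grpring R G]_m) : rat :=
  \sum_(j < m) gr_l1 (x 0 j).

(* A finitely generated free module with a fixed basis of m elements is
   'rV_m with its standard basis. *)
Definition filling_norm (G : groupType) (M : lmodType (grpring R G))
    (N : M -> K) : Prop :=
  exists (m : nat) (rho : {linear 'rV[grpring R G]_m -> M}),
    (forall y, exists x, rho x = y) /\
    forall y, N y = inf [set ratr (free_l1 x) | x in [set x | rho x = y]].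

(* The choices on which FV^(n+1)_(G,R) depends. *)
Record filling_data (G : groupType) (n : nat) := FillingData {
  fd_res : augcomplex (trivmod R G);
  fd_resP : fg_partial_projres fd_res n.+1;
  fd_int : set (term fd_res n);
  fd_intP : integral_part (cycles fd_res n) fd_int;
  fd_norm : term fd_res n -> K;
  fd_normP : filling_norm fd_norm;
  fd_norm1 : term fd_res n.+1 -> K;
  fd_norm1P : filling_norm fd_norm1
}.
#[global] Arguments fd_int [G n] f.
#[global] Arguments fd_norm [G n] f y.
#[global] Arguments fd_norm1 [G n] f y.

Definition bd_norm (G : groupType) (n : nat) (D : filling_data G n)
    (y : term (fd_res D) n) : \bar K :=
  ereal_inf [set (fd_norm1 D mu)%:E | mu in [set mu | bd (fd_res D) n mu = y]].

(* FV^(n+1); [maxe 0%:E] implements the convention that the supremum of the empty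
   set is 0 rather than -oo. *)
Definition FV (G : groupType) (n : nat) (D : filling_data G n) (k : nat) :
    \bar K :=
  maxe 0%:E (ereal_sup
    [set bd_norm y | y in fd_int D `&` [set y | fd_norm D y <= k%:R]]).

End Filling.

Definition preceq (K : realType) (f g : nat -> \bar K) : Prop :=
  exists C : nat, (0 < C)%N /\
    forall k : nat,
      (f k <= C%:R%:E * g (C * k + C)%N + (C * k + C)%:R%:E)%E.

(* Main.v *)
(* Let P and Y be the given partial resolutions over RG and RH. Restricted to H,
   P still consists of projective modules, so there are RH-chain maps f : Y -> P
   and g : P -> Y with g f homotopic to the identity through h. As G has
   cohomological dimension n + 1, the n-cycles of P form a projective module;
   hence there is an RG-endomorphism e of P_(n+1) with d e = d which vanishes on
   the kernel of d, so that e mu depends only on d mu.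

   Let y = d v be an n-cycle of Y, and w = e (f v). Then g w + h y fills y, and h
   is bounded since Y_n is finitely generated. The map g is not bounded on all of
   P_(n+1), which is not finitely generated over RH, but it is on the image of
   e f, whose elements have coefficients supported in HS for a fixed finite set
   S. Finally w = e mu for any filling mu of f y, so the norm of w is at most a
   constant times the norm of mu. A common denominator N takes care of the
   integral parts: N f maps that of H to that of G, and N w = e mu for any
   filling mu of N f y. *)

From HB Require Import structures.
Require Import Defs.
From mathcomp Require Import all_boot all_order all_algebra finmap.
From mathcomp.multinomials Require Import monalg.
From mathcomp Require Import all_classical reals ereal.

Set Implicit Arguments.
Unset Strict Implicit.
Unset Printing Implicit Defensive.

Import Order.TTheory GRing.Theory Num.Theory.

Local Open Scope classical_set_scope.
Local Open Scope ring_scope.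

(** * Linear maps from functions, dependent choice, and lifting through an image *)

Section LinearOf.
Context (A : nzRingType) (U V : lmodType A) (f : U -> V).

Lemma linear_ofP (hf : linear f) : exists g : {linear U -> V}, g =1 f.
Proof.
pose fL := GRing.isLinear.Build A U V *:%R f hf.
pose g : {linear U -> V} := HB.pack f fL.
by exists g.
Qed.

End LinearOf.

(** Chain maps are built degree by degree with it: [I] records what the next lift needs, so the
    recursion runs on terms paired with a proof of [I]. *)
Lemma dependent_choice (T : nat -> Type) (I : forall i, T i -> Prop)
    (S : forall i, T i -> T i.+1 -> Prop) (t0 : T 0%N) :
  I 0%N t0 ->
  (forall i t, I i t -> exists t', S i t t' /\ I i.+1 t') ->
  exists f : forall i, T i, f 0%N = t0 /\ forall i, S i (f i) (f i.+1).
Proof.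
move=> It0 step.
pose F := fix F i : {t : T i | I i t} :=
  match i with
  | 0%N => exist _ t0 It0
  | j.+1 => let: (exist t It) := F j in
            exist _ (projT1 (cid (step j t It)))
                    (proj2 (projT2 (cid (step j t It))))
  end.
exists (fun i => proj1_sig (F i)); split=> // i /=.
by case: (F i) => t It /=; case: (cid _) => t' [].
Qed.

Section Image.
Context (A : nzRingType) (M N : lmodType A) (f : {linear M -> N}).

Definition lim_pred : {pred N} := fun y => `[< exists x, f x = y >].

Lemma lim_pred_closed : submod_closed lim_pred.
Proof.
split=> [|a u v /asboolP[x fx] /asboolP[y fy]]; apply/asboolP.
  by exists 0; rewrite linear0.
by exists (a *: x + y); rewrite linearP fx fy.
Qed.

HB.instance Definition _ :=
  GRing.isSubmodClosed.Build A N lim_pred lim_pred_closed.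

Record limage := LImage { limval : N; _ : limval \in lim_pred }.

HB.instance Definition _ := [isSub for limval].
HB.instance Definition _ := [Choice of limage by <:].
HB.instance Definition _ := [SubChoice_isSubLmodule of limage by <:].

End Image.

(** [projective] lifts only along surjections; corestricting [f] and [g] to the image of [f]
    provides one. *)
Lemma projective_lift (A : nzRingType) (P M N : lmodType A)
    (f : {linear M -> N}) (g : {linear P -> N}) :
  projective P -> (forall x, range f (g x)) ->
  exists h : {linear P -> M}, forall x, f (h x) = g x.
Proof.
move=> prP fg.
have memf x : f x \in lim_pred f by apply/asboolP; exists x.
have memg x : g x \in lim_pred f.
  by apply/asboolP; case: (fg x) => y _ <-; exists y.
pose f' x : limage f := LImage (memf x).
pose g' x : limage f := LImage (memg x).
have [|fL fLE] := @linear_ofP A M (limage f) f'.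
  by move=> a x y; apply: val_inj; rewrite /= linearP.
have [|gL gLE] := @linear_ofP A P (limage f) g'.
  by move=> a x y; apply: val_inj; rewrite /= linearP.
have [y|h hE] := prP _ _ fL gL.
  have /asboolP[x fx] : val y \in lim_pred f by case: y.
  by exists x; apply: val_inj; rewrite fLE.
exists h => x; have := congr1 val (hE x).
by rewrite fLE gLE.
Qed.

(** * Comparison of partial resolutions *)

Section Comparison.
Context (A : nzRingType) (X : lmodType A).
Implicit Types C D : augcomplex X.

Lemma bd_cycles C m : exact_upto C m ->
  forall i x, (i < m)%N -> cycles C i (bd C i x).
Proof. by move=> [_ ex] i x lt_im; rewrite ex //; exists x. Qed.

Lemma chain_map_exists C D m :
  (forall i, (i <= m)%N -> projective (term C i)) ->
  exact_upto C m -> exact_upto D m ->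
  exists f : forall i, {linear term C i -> term D i},
    (forall x, augmap D (f 0%N x) = augmap C x) /\
    forall i x, (i < m)%N -> bd D i (f i.+1 x) = f i (bd C i x).
Proof.
move=> prC exC exD.
have [f0 f0E] : exists h : {linear term C 0 -> term D 0},
    forall x, augmap D (h x) = augmap C x.
  apply: projective_lift; first exact: prC.
  by move=> x; have [y <-] := exD.1 (augmap C x); exists y.
pose T i := {linear term C i -> term D i}.
pose I i (f : T i) :=
  (i < m)%N -> forall x, cycles C i x -> cycles D i (f x).
pose S i (f : T i) (f' : T i.+1) :=
  (i < m)%N -> forall x, bd D i (f' x) = f (bd C i x).
have [||f [f0E' fS]] := @dependent_choice T I S f0.
- by move=> _ x /= x0; rewrite f0E.
- move=> i t It; have [lt_im|le_mi] := ltnP i m; last first.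
    exists \0; split=> [lt|].
      by move: (leq_trans lt le_mi); rewrite ltnn.
    by move=> lt x _ /=; rewrite linear0.
  have [||h hE] := @projective_lift A (term C i.+1) _ _ (bd D i) (t \o bd C i).
  + exact: prC.
  + move=> x; rewrite -exD.2 //; apply: It => //.
    exact: (bd_cycles exC).
  exists h; split=> [_|lt x /= x0]; first exact: hE.
  by rewrite hE /= x0 linear0.
exists f; split; first by rewrite f0E'.
by move=> i x lt; apply: fS.
Qed.

(** In u = d s + s d the second term vanishes on cycles. The remaining identity carries the
    induction: boundaries are cycles, so u - s d has values in the cycles of [D] and lifts along the
    next boundary. *)
Lemma homotopy_exists C D m (u : forall i, {linear term C i -> term D i}) :
  (forall i, (i <= m)%N -> projective (term C i)) ->
  exact_upto C m -> exact_upto D m ->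
  (forall x, augmap D (u 0%N x) = 0) ->
  (forall i x, (i < m)%N -> bd D i (u i.+1 x) = u i (bd C i x)) ->
  forall i, (i < m)%N -> exists s : {linear term C i -> term D i.+1},
    forall x, cycles C i x -> u i x = bd D i (s x).
Proof.
move=> prC exC exD u0 uS.
elim=> [|i IHi] lt_im.
  have [||s sE] := @projective_lift A (term C 0) _ _ (bd D 0) (u 0%N).
  - exact: prC.
  - by move=> x; rewrite -exD.2 //; apply: u0.
  by exists s => x _; rewrite sE.
have lt_im' := ltnW lt_im; have [s sE] := IHi lt_im'.
pose v : {linear term C i.+1 -> term D i.+1} := u i.+1 \- (s \o bd C i).
have [||s' s'E] := @projective_lift A (term C i.+1) _ _ (bd D i.+1) v.
- exact: prC.
- move=> x; rewrite -exD.2 //= linearB uS //.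
  by rewrite -sE ?subrr //; exact: (bd_cycles exC).
by exists s' => x /= x0; rewrite s'E /= x0 linear0 subr0.
Qed.

End Comparison.

(* phi is a parameter of the alias so that the A-module structure can be inferred
   from the type. *)
Definition resscal (A B : nzRingType) (phi : {rmorphism A -> B})
  (M : lmodType B) : Type := M.

(** * Restriction of scalars *)

Section ResScal.
Context (A B : nzRingType) (phi : {rmorphism A -> B}).
Notation resscal := (resscal phi).

HB.instance Definition _ (M : lmodType B) :=
  GRing.Zmodule.copy (resscal M) M.

Section Scale.
Context (M : lmodType B).

Definition res_scale (a : A) (x : resscal M) : resscal M := phi a *: (x : M).

Lemma res_scaleA a b x : res_scale a (res_scale b x) = res_scale (a * b) x.
Proof. by rewrite /res_scale scalerA rmorphM. Qed.

Lemma res_scale1 : left_id 1 res_scale.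
Proof. by move=> x; rewrite /res_scale rmorph1 scale1r. Qed.

Lemma res_scaleDr : right_distributive res_scale +%R.
Proof. by move=> a x y; rewrite /res_scale scalerDr. Qed.

Lemma res_scaleDl x : {morph res_scale^~ x : a b / a + b}.
Proof. by move=> a b; rewrite /res_scale rmorphD scalerDl. Qed.

HB.instance Definition _ := GRing.Zmodule_isLmodule.Build A (resscal M)
  res_scaleA res_scale1 res_scaleDr res_scaleDl.

Lemma res_scaleE (a : A) (x : resscal M) : a *: x = phi a *: (x : M) :> M.
Proof. by []. Qed.

End Scale.

Section Map.
Context (M N : lmodType B) (f : {linear M -> N}).

Definition res_map (x : resscal M) : resscal N := f x.

Lemma res_map_linear : linear res_map.
Proof. by move=> a x y; rewrite /res_map linearD [f _]linearZ. Qed.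

HB.instance Definition _ :=
  GRing.isLinear.Build A (resscal M) (resscal N) *:%R res_map res_map_linear.

End Map.
End ResScal.

(** * Additive maps on the group ring, prescribed on monomials *)

Lemma gr_monomialE (R : nzRingType) (G : groupType) (a : grpring R G) :
  a = \sum_(t <- msupp a) (<< a@_t *g t >> : grpring R G).
Proof. exact: monalgE. Qed.

Section Monomials.
Context (R : nzRingType) (G : groupType) (V : zmodType).

Lemma eq_gr_monomial (f g : {additive grpring R G -> V}) :
  (forall r t, f << r *g t >> = g << r *g t >>) -> f =1 g.
Proof.
move=> fg a; rewrite (gr_monomialE a).
by rewrite !raddf_sum; apply: eq_bigr.
Qed.

Section Extension.
Context (F : R -> G -> V) (FB : forall t, zmod_morphism (F^~ t)).

Definition gr_extend (a : grpring R G) : V := \sum_(t <- msupp a) F a@_t t.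

Let F0 t : F 0 t = 0. Proof. by rewrite -(subrr (0 : R)) FB subrr. Qed.

Lemma gr_extendw (d : {fset G}) (a : grpring R G) :
  (msupp a `<=` d)%fset -> gr_extend a = \sum_(t <- d) F a@_t t.
Proof. by move=> le_d; apply: big_fset_incl => // t _ /mcoeff_outdom ->. Qed.

Lemma gr_extendU r t : gr_extend << r *g t >> = F r t.
Proof. by rewrite (gr_extendw msuppU_le) big_seq_fset1 mcoeffUU. Qed.

Lemma gr_extend_zmod_morphism : zmod_morphism gr_extend.
Proof.
move=> a b; rewrite (gr_extendw (msuppB_le a b)).
rewrite (gr_extendw (fsubsetUl (msupp a) (msupp b))).
rewrite (gr_extendw (fsubsetUr (msupp a) (msupp b))) -sumrB.
by apply/eq_bigr => t _; rewrite mcoeffB FB.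
Qed.

End Extension.

Lemma gr_extension (F : R -> G -> V) : (forall t, zmod_morphism (F^~ t)) ->
  exists f : {additive grpring R G -> V}, forall r t, f << r *g t >> = F r t.
Proof.
move=> FB; pose fB := GRing.isZmodMorphism.Build (grpring R G) V (gr_extend F)
  (gr_extend_zmod_morphism FB).
pose f : {additive grpring R G -> V} := HB.pack (gr_extend F) fB.
by exists f => r t; exact: gr_extendU.
Qed.

End Monomials.

(** * The inclusion of RH in RG *)

Section Subgroup.
Context (R : nzRingType) (G : groupType) (SH : {pred G}) (H : subGroupType SH).

Definition gr_incl (a : grpring R H) : grpring R G :=
  \sum_(h <- msupp a) << a@_h *g val h >>.

Lemma gr_incl_zmod_morphism : zmod_morphism gr_incl.
Proof.
apply: (@gr_extend_zmod_morphism R H (grpring R G)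
  (fun r h => << r *g val h >>)).
by move=> h r s /=; rewrite monalgUB.
Qed.

HB.instance Definition _ := GRing.isZmodMorphism.Build (grpring R H)
  (grpring R G) gr_incl gr_incl_zmod_morphism.

Lemma gr_inclU r h : gr_incl << r *g h >> = << r *g val h >>.
Proof.
apply: (@gr_extendU R H (grpring R G) (fun r h => << r *g val h >>)).
by move=> t r' s /=; rewrite monalgUB.
Qed.

Lemma gr_incl_monoid_morphism : monoid_morphism gr_incl.
Proof.
split=> [|a b]; first by rewrite [1]/(gr_one R H) gr_inclU val1.
rewrite [a * b]/(gr_mul a b) raddf_sum /= mulr_suml; apply/eq_bigr => g _.
rewrite raddf_sum /= mulr_sumr; apply/eq_bigr => h _.
by rewrite gr_inclU valM; exact/esym/gr_mulUU.
Qed.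

HB.instance Definition _ := GRing.isMonoidMorphism.Build (grpring R H)
  (grpring R G) gr_incl gr_incl_monoid_morphism.

Lemma gr_aug_incl (a : grpring R H) : gr_aug (gr_incl a) = gr_aug a.
Proof.
apply: (@eq_gr_monomial R H R (@gr_aug R G \o gr_incl) (@gr_aug R H)) => r t /=.
by rewrite gr_inclU !gr_augU.
Qed.

End Subgroup.

Lemma gr_incl_of_int (R : nzRingType) (G : groupType) (SH : {pred G})
    (H : subGroupType SH) (c : grpring int H) :
  gr_incl (gr_of_int R c) = gr_of_int R (gr_incl c) :> grpring R G.
Proof.
pose f : {additive _ -> _} := @gr_incl R G SH H \o @gr_of_int R H.
pose g : {additive _ -> _} := @gr_of_int R G \o @gr_incl int G SH H.
apply: (@eq_gr_monomial int H (grpring R G) f g) => r t /=.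
by rewrite gr_of_intU !gr_inclU gr_of_intU.
Qed.

Lemma fin_gen_free (A : nzRingType) (M : lmodType A) : fin_gen M ->
  exists (m : nat) (p : {linear 'rV[A]_m -> M}), forall x, exists y, p y = x.
Proof.
move=> [m [e eP]]; exists m.
have [|p pE] := @linear_ofP A 'rV[A]_m M (fun v => \sum_i v 0 i *: e i).
  move=> a u v; rewrite scaler_sumr -big_split /=; apply: eq_bigr => i _.
  by rewrite !mxE scalerDl scalerA.
exists p => x; have [c ->] := eP x; exists (\row_i c i).
by rewrite pE; apply: eq_bigr => i _; rewrite mxE.
Qed.

Lemma projective_section (A : nzRingType) (P M : lmodType A)
    (p : {linear M -> P}) :
  projective P -> (forall x, exists y, p y = x) ->
  exists s : {linear P -> M}, forall x, p (s x) = x.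
Proof. by move=> prP pS; have [s sE] := prP _ _ p idfun pS; exists s. Qed.

(** * Cosets, and restriction of projective resolutions to H *)

Section Cosets.
Context (G : groupType) (SH : {pred G}) (H : subGroupType SH).

(** [co t] is the right coset Ht. The choice made by [xget] depends on the set alone, so a whole
    coset shares its representative; cancelling it gives the equivariance of [h]. *)
Lemma coset_representatives : exists (h : G -> H) (rep : G -> G),
  (forall t, t = (val (h t) * rep t)%g) /\
  forall k t, h (val k * t)%g = (k * h t)%g /\ rep (val k * t)%g = rep t.
Proof.
pose co t : set G := [set s | exists k : H, t = (val k * s)%g].
pose rep t := xget 1%g (co t).
have repP t : co t (rep t).
  by apply: (@xgetI _ _ _ t); exists 1%g; rewrite val1 mul1g.
have [h hP] := choice repP; exists h, rep.
have repM (k : H) t : rep (val k * t)%g = rep t.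
  congr xget; apply/seteqP; split=> s [l].
    by move=> tE; exists (k^-1 * l)%g; rewrite valM gmulfV -mulgA -tE mulKg.
  by move=> ->; exists (k * l)%g; rewrite valM mulgA.
split=> // k t; split=> //; apply: val_inj; rewrite valM.
have := hP (val k * t)%g; rewrite {1}(hP t) repM mulgA.
by move/mulIg.
Qed.

End Cosets.

Section RestrictProjective.
Context (R : nzRingType) (G : groupType) (SH : {pred G}) (H : subGroupType SH).

Notation res := (resscal (@gr_incl R G SH H)).
Notation resm := (@res_map _ _ (@gr_incl R G SH H) _ _).

(* RG is free over RH on the right coset representatives, so it is enough to
   lift the values taken there. *)
Lemma res_free_lift (m : nat) (M N : lmodType (grpring R H))
    (f : {linear M -> N}) (g : {linear res 'rV[grpring R G]_m -> N}) :
  (forall y, exists x, f x = y) ->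
  exists l : {linear res 'rV[grpring R G]_m -> M}, forall x, f (l x) = g x.
Proof.
move=> fS; have [h [rep [hrepE hrepM]]] := coset_representatives H.
pose U r t : grpring R G := << r *g t >>.
pose c r t : grpring R H := << r *g t >>.
have /choice[w wE] (jt : 'I_m * G) :
    exists x, f x = g (U 1 jt.2 *: delta_mx 0 jt.1).
  exact: fS.
(* As r t e_j = (r h(t)) (rep(t) e_j), RH-linearity forces this value once [w] is chosen. *)
pose F (j : 'I_m) r t : M := c r (h t) *: w (j, rep t).
have FB j t : zmod_morphism ((F j)^~ t).
  by move=> r s; rewrite /F /c monalgUB scalerBl.
have /choice[E EE] j := gr_extension (FB j).
have EM j b a : E j (gr_incl b * a) = b *: E j a.
  rewrite (gr_monomialE b).
  rewrite (raddf_sum (@gr_incl R G SH H)) mulr_suml (raddf_sum (E j)).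
  rewrite scaler_suml; apply: eq_bigr => k _.
  rewrite (gr_monomialE a).
  rewrite mulr_sumr !(raddf_sum (E j)) scaler_sumr; apply: eq_bigr => t _ /=.
  rewrite gr_inclU [_ * _]gr_mulUU !EE /F scalerA.
  have [-> ->] := hrepM k t; congr (_ *: _).
  exact/esym/gr_mulUU.
have [|l lE] := @linear_ofP (grpring R H) (res 'rV[grpring R G]_m) M
    (fun v => \sum_j E j (v 0 j)).
  move=> b u v; rewrite scaler_sumr -big_split /=; apply: eq_bigr => j _.
  by rewrite !mxE raddfD EM.
have gE j a : f (E j a) = g (a *: delta_mx 0 j).
  rewrite (gr_monomialE a).
  rewrite scaler_suml !raddf_sum; apply: eq_bigr => t _ /=.
  rewrite EE /F linearZ wE /=.
  transitivity (g (c a@_t (h t) *: (U 1 (rep t) *: delta_mx 0 j : res _))).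
    by rewrite linearZ.
  congr (g _); rewrite res_scaleE scalerA.
  apply: (congr1 (fun b : grpring R G => b *: (delta_mx 0 j : 'rV_m))).
  transitivity (gr_mul (gr_incl (c a@_t (h t))) (U 1 (rep t))) => //.
  by rewrite gr_inclU gr_mulUU mulr1 -hrepE.
exists l => x; rewrite lE raddf_sum [x in RHS]row_sum_delta raddf_sum.
by apply: eq_bigr => j _; exact: gE.
Qed.

Section Augmentation.
Context (M : lmodType (grpring R G)) (a : {linear M -> trivmod R G}).

Definition res_aug (x : res M) : trivmod R H := a x.

Lemma res_aug_linear : linear res_aug.
Proof.
move=> b x y; rewrite /res_aug linearD [a _]linearZ.
by congr (_ + _); rewrite [LHS]/(triv_scale _ _) /triv_scale gr_aug_incl.
Qed.

HB.instance Definition _ := GRing.isLinear.Build (grpring R H) (res M)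
  (trivmod R H) *:%R res_aug res_aug_linear.

End Augmentation.

(** P is a retract of a free module of finite rank, and the lifting property passes to retracts. *)
Lemma res_projective (P : lmodType (grpring R G)) :
  projective P -> fin_gen P -> projective (res P).
Proof.
move=> prP /fin_gen_free[m [p pS]] M N f g fS.
have [s sE] := projective_section prP pS.
have [l lE] := res_free_lift (g \o resm p) fS.
exists (l \o resm s) => x; rewrite /= lE /=.
by congr (g _); exact: sE.
Qed.

Definition res_complex (C : augcomplex (trivmod R G)) :
    augcomplex (trivmod R H) :=
  @AugComplex (grpring R H) (trivmod R H)
    (fun i => res (term C i) : lmodType (grpring R H))
    (fun i => resm (bd C i)) (res_aug (augmap C)).

Lemma res_cycles (C : augcomplex (trivmod R G)) i :
  cycles (res_complex C) i = cycles C i.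
Proof. by case: i. Qed.

Lemma res_exact (C : augcomplex (trivmod R G)) m :
  exact_upto C m -> exact_upto (res_complex C) m.
Proof.
by move=> [aS ex]; split=> // i lt_im; rewrite res_cycles ex.
Qed.

End RestrictProjective.

(** * The l1-norm on group rings and free modules *)

Section GroupRingNorm.
Context (Q : {pred rat}) (R : subNzRingType Q) (G : groupType).
Implicit Types a b : grpring R G.

Lemma gr_l1w (d : {fset G}) a :
  (msupp a `<=` d)%fset -> gr_l1 a = \sum_(g <- d) `|val a@_g|.
Proof.
move=> le_d; apply: big_fset_incl => // g _ /mcoeff_outdom ->.
by rewrite raddf0 normr0.
Qed.

Lemma gr_l1_ge0 a : 0 <= gr_l1 a.
Proof. exact: sumr_ge0. Qed.

Lemma gr_l1_0 : gr_l1 (0 : grpring R G) = 0.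
Proof. by rewrite /gr_l1 msupp0 big_seq_fset0. Qed.

Lemma gr_l1U r (t : G) : gr_l1 (<< r *g t >> : grpring R G) = `|val r|.
Proof. by rewrite (gr_l1w msuppU_le) big_seq_fset1 mcoeffUU. Qed.

Lemma gr_l1D a b : gr_l1 (a + b) <= gr_l1 a + gr_l1 b.
Proof.
rewrite (gr_l1w (msuppD_le a b)) (gr_l1w (fsubsetUl (msupp a) (msupp b))).
rewrite (gr_l1w (fsubsetUr (msupp a) (msupp b))) -big_split /=.
by apply: ler_sum => g _; rewrite mcoeffD raddfD ler_normD.
Qed.

Lemma gr_l1_sum (I : Type) (s : seq I) (F : I -> grpring R G) :
  gr_l1 (\sum_(i <- s) F i) <= \sum_(i <- s) gr_l1 (F i).
Proof.
elim/big_rec2: _ => [|i y x _ le_xy]; first by rewrite gr_l1_0.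
by apply: le_trans (gr_l1D _ _) _; rewrite lerD2l.
Qed.

Lemma gr_l1M a b : gr_l1 (a * b) <= gr_l1 a * gr_l1 b.
Proof.
apply: le_trans (gr_l1_sum _ _) _; rewrite mulr_suml.
apply: ler_sum => g _; apply: le_trans (gr_l1_sum _ _) _; rewrite mulr_sumr.
by apply: ler_sum => h _; rewrite gr_l1U rmorphM normrM.
Qed.

Lemma gr_l1Mn a n : gr_l1 (a *+ n) = gr_l1 a *+ n.
Proof.
rewrite [LHS](@gr_l1w (msupp a)); last first.
  apply/fsubsetP => g; rewrite -!mcoeff_neq0 mcoeffMn; apply: contraNneq => ->.
  by rewrite mul0rn.
rewrite /gr_l1 -sumrMnl; apply: eq_bigr => g _.
by rewrite mcoeffMn raddfMn normrMn.
Qed.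

(** This allows a denominator to be dropped again. It can fail for filling norms: on the integers
    with generators 2 and 3, the element 1 has norm 2 but its double has norm 1. *)
Lemma free_l1Mn_ge m n (x : 'rV[grpring R G]_m) :
  (0 < n)%N -> free_l1 x <= free_l1 (x *+ n).
Proof.
case: n => // n _; apply: ler_sum => j _.
by rewrite mulmxnE gr_l1Mn mulrS lerDl mulrn_wge0 // gr_l1_ge0.
Qed.

End GroupRingNorm.

Lemma sum_neq0_ex (V : nmodType) (I : eqType) (s : seq I) (F : I -> V) :
  \sum_(i <- s) F i != 0 -> exists2 i, i \in s & F i != 0.
Proof.
move=> F_neq0; have /hasP[i] : has (fun i => F i != 0) s.
  apply: contraNT F_neq0 => /hasPn F0; rewrite big1_seq // => i /andP[_ /F0].
  by move/negPn/eqP.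
by exists i.
Qed.

Lemma gr_coefM_neq0 (R : nzRingType) (G : groupType) (a b : grpring R G) t :
  (a * b)@_t != 0 ->
  exists g s, [/\ a@_g != 0, b@_s != 0 & t = (g * s)%g].
Proof.
rewrite raddf_sum => /sum_neq0_ex[g ag]; rewrite raddf_sum => /sum_neq0_ex[s bs].
rewrite /= mcoeffU; case: (_ =P t) => [<- _|]; last by rewrite eqxx.
by exists g, s; rewrite !mcoeff_neq0.
Qed.

Lemma gr_coef_incl_neq0 (R : nzRingType) (G : groupType) (SH : {pred G})
    (H : subGroupType SH) (a : grpring R H) g :
  (gr_incl a)@_g != 0 -> exists h : H, g = val h.
Proof.
rewrite raddf_sum => /sum_neq0_ex[h _] /=.
by rewrite mcoeffU; case: (_ =P g) => [<- _|]; [exists h|rewrite eqxx].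
Qed.

Lemma gr_l1_incl (Q : {pred rat}) (R : subNzRingType Q) (G : groupType)
    (SH : {pred G}) (H : subGroupType SH) (a : grpring R H) :
  gr_l1 (gr_incl a) <= gr_l1 a.
Proof.
by apply: le_trans (gr_l1_sum _ _) _; apply: ler_sum => h _; rewrite gr_l1U.
Qed.

(** * Filling norms and bounded linear maps *)

Section Seminorms.
Context (K : realType) (Q : {pred rat}) (R : subNzRingType Q).

(** Unlike being a filling norm, these properties survive restriction to a subgroup, where finite
    generation may be lost. *)
Definition l1_seminorm (G : groupType) (M : lmodType (grpring R G))
    (N : M -> K) : Prop :=
  [/\ forall x, 0 <= N x, forall x y, N (x + y) <= N x + N y &
      forall a x, N (a *: x) <= ratr (gr_l1 a) * N x].

Section OneGroup.
Context (G : groupType).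
Implicit Types M : lmodType (grpring R G).

Lemma l1_seminorm_sum M (N : M -> K) (I : Type) (s : seq I) (F : I -> M) :
  l1_seminorm N -> N (\sum_(i <- s) F i) <= \sum_(i <- s) N (F i).
Proof.
move=> [N0 ND NZ]; elim/big_rec2: _ => [|i y x _ le_xy].
  by have := NZ 0 0; rewrite scale0r gr_l1_0 rmorph0 mul0r.
by apply: le_trans (ND _ _) _; rewrite lerD2l.
Qed.

Definition free_norm m (x : 'rV[grpring R G]_m) : K := ratr (free_l1 x).

Lemma free_norm_seminorm m : l1_seminorm (@free_norm m).
Proof.
split=> [x|x y|a x]; rewrite /free_norm.
- by rewrite ler0q sumr_ge0 // => j _; rewrite gr_l1_ge0.
- rewrite -rmorphD ler_rat -big_split; apply: ler_sum => j _.
  by rewrite mxE gr_l1D.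
- rewrite -rmorphM ler_rat mulr_sumr; apply: ler_sum => j _.
  by rewrite mxE gr_l1M.
Qed.

(** The last clause is the infimum in usable form: a bound c <= C N(y) may be checked on the
    preimages of y in the free module. *)
Lemma filling_normP M (N : M -> K) : filling_norm N ->
  exists (m : nat) (rho : {linear 'rV[grpring R G]_m -> M}),
    [/\ forall y, exists x, rho x = y,
        forall x, N (rho x) <= free_norm x &
        forall y c C, 0 <= C ->
          (forall x, rho x = y -> c <= C * free_norm x) -> c <= C * N y].
Proof.
move=> [m [rho [rhoS NE]]]; exists m, rho; split=> // [x|y c C C0 cP].
  rewrite NE; apply: ge_inf; last by exists x.
  by exists 0 => _ [z _ <-]; have [F0 _ _] := free_norm_seminorm m; exact: F0.
have [x xy] := rhoS y; have := C0; rewrite le_eqVlt => /predU1P[CE|C_gt0].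
  by have := cP _ xy; rewrite -CE !mul0r.
rewrite -ler_pdivrMl // NE; apply: lb_le_inf; first by exists (free_norm x), x.
by move=> _ [z zy <-]; rewrite ler_pdivrMl //; exact: cP.
Qed.

Lemma filling_seminorm M (N : M -> K) : filling_norm N -> l1_seminorm N.
Proof.
move=> /filling_normP[m [rho [rhoS le_N ge_N]]].
have [F0 FD FZ] := free_norm_seminorm m; split=> [x|x y|a x].
- by rewrite -[N x]mul1r; apply: ge_N => // z _; rewrite mul1r.
- rewrite -lerBlDl -[N y]mul1r; apply: (ge_N) => // v vy.
  rewrite mul1r lerBlDl -lerBlDr -[N x]mul1r; apply: ge_N => // u ux.
  rewrite mul1r lerBlDr; apply: le_trans (FD _ _).
  by rewrite -ux -vy -linearD.
- apply: ge_N; first by rewrite ler0q gr_l1_ge0.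
  by move=> z zx; apply: le_trans (FZ _ _); rewrite -zx -linearZ.
Qed.

(** The images of the finitely many basis vectors control the map. The constant is a natural number
    because [preceq] wants an integer. *)
Lemma bounded_free m M (N : M -> K) (phi : {linear 'rV[grpring R G]_m -> M}) :
  l1_seminorm N -> exists C : nat, forall x, N (phi x) <= C%:R * free_norm x.
Proof.
move=> sN; have [N0 ND NZ] := sN.
pose c := \sum_j N (phi (delta_mx 0 j)).
exists (Num.bound c) => x.
rewrite {1}(row_sum_delta x) linear_sum /=.
apply: le_trans (l1_seminorm_sum _ _ sN) _.
rewrite /free_norm rmorph_sum mulr_sumr; apply: ler_sum => j _.
rewrite linearZ mulrC; apply: le_trans (NZ _ _) _.
apply: ler_wpM2l; first by rewrite ler0q gr_l1_ge0.
apply: le_trans (ltW (archi_boundP _)); last exact: sumr_ge0.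
by rewrite /c (bigD1 j) //= lerDl sumr_ge0.
Qed.

Lemma bounded_filling M M' (N : M -> K) (N' : M' -> K)
    (phi : {linear M -> M'}) :
  filling_norm N -> l1_seminorm N' ->
  exists C : nat, forall x, N' (phi x) <= C%:R * N x.
Proof.
move=> /filling_normP[m [rho [rhoS le_N ge_N]]] sN'.
have [C CP] := bounded_free (phi \o rho) sN'.
by exists C => x; apply: ge_N => // z <-; exact: CP.
Qed.

End OneGroup.

Section Subgroup.
Context (G : groupType) (SH : {pred G}) (H : subGroupType SH).

Notation res := (resscal (@gr_incl R G SH H)).

Lemma res_seminorm (M : lmodType (grpring R G)) (N : M -> K) :
  l1_seminorm N -> @l1_seminorm H (res M) N.
Proof.
move=> [N0 ND NZ]; split=> // a x; apply: le_trans (NZ _ _) _.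
by rewrite ler_wpM2r // ler_rat gr_l1_incl.
Qed.

(* The coefficients of the image of theta are supported in HS for a finite S,
   and the image under psi of a monomial (hs) e_j is as large as that of s e_j. *)
Lemma bounded_on_fin_gen_image m (M M' : lmodType (grpring R H)) (N : M' -> K)
    (theta : {linear M -> res 'rV[grpring R G]_m})
    (psi : {linear res 'rV[grpring R G]_m -> M'}) :
  fin_gen M -> l1_seminorm N ->
  exists C : nat, forall x, N (psi (theta x)) <= C%:R * free_norm (theta x).
Proof.
move=> [p [e eP]] sN; have [N0 ND NZ] := sN.
pose th x : 'rV[grpring R G]_m := theta x.
pose U r t : grpring R G := << r *g t >>.
pose c t j := N (psi (U 1 t *: delta_mx 0 j)).
have c_ge0 t j : 0 <= c t j by exact: N0.
pose B2 j i := \sum_(s <- msupp (th (e i) 0 j)) c s j.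
(* The set S is the union of the supports of the coefficients of the [theta (e i)]; [B] dominates
   [c s j] whenever s is in the support of coordinate j of some generator image. *)
pose B := \sum_j \sum_i B2 j i.
have B2_ge0 j i : 0 <= B2 j i by exact: sumr_ge0.
have cB j i s : s \in msupp (th (e i) 0 j) -> c s j <= B.
  move=> s_supp; apply: (@le_trans _ _ (B2 j i)).
    by rewrite /B2 (big_rem s) //= lerDl sumr_ge0.
  rewrite /B (bigD1 j) //= (bigD1 i) //= -addrA lerDl.
  by rewrite addr_ge0 ?sumr_ge0 // => j' _; rewrite sumr_ge0.
have psiU j r (h : H) s : N (psi (U r (val h * s)%g *: delta_mx 0 j)) <=
    ratr `|val r| * c s j.
  pose b : grpring R H := << r *g h >>.
  have -> : U r (val h * s)%g *: delta_mx 0 j =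
      b *: (U 1 s *: delta_mx 0 j : res 'rV[grpring R G]_m).
    rewrite res_scaleE scalerA.
    apply: (congr1 (fun b : grpring R G => b *: (delta_mx 0 j : 'rV_m))).
    transitivity (gr_mul (gr_incl b) (U 1 s)) => //.
    by rewrite gr_inclU gr_mulUU mulr1.
  by rewrite linearZ; apply: le_trans (NZ _ _) _; rewrite gr_l1U.
exists (Num.bound B) => x.
have supp j t : t \in msupp (th x 0 j) -> exists (h : H) i s,
    s \in msupp (th (e i) 0 j) /\ t = (val h * s)%g.
  rewrite -mcoeff_neq0; have [a ->] := eP x.
  have -> : th (\sum_i a i *: e i) 0 j = \sum_i gr_incl (a i) * th (e i) 0 j.
    rewrite /th linear_sum summxE; apply: eq_bigr => i _.
    by rewrite linearZ [LHS]mxE.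
  rewrite raddf_sum => /sum_neq0_ex[i _].
  move=> /gr_coefM_neq0[g [s [/gr_coef_incl_neq0[h ->] s_supp ->]]].
  by exists h, i, s; rewrite -mcoeff_neq0.
(* Expanding [theta x] itself, not its expression through the generators, makes the coefficients add
   up to exactly its l1-norm, whatever cancellation occurred. *)
have thE : theta x = \sum_j \sum_(t <- msupp (th x 0 j))
    (U (th x 0 j)@_t t *: delta_mx 0 j : res 'rV[grpring R G]_m).
  rewrite [LHS](row_sum_delta (th x)); apply: eq_bigr => j _.
  by rewrite {1}(gr_monomialE (th x 0 j)) scaler_suml.
rewrite {1}thE linear_sum /=; apply: le_trans (l1_seminorm_sum _ _ sN) _.
rewrite /free_norm /free_l1 rmorph_sum mulr_sumr; apply: ler_sum => j _.
rewrite linear_sum /=; apply: le_trans (l1_seminorm_sum _ _ sN) _.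
rewrite rmorph_sum mulr_sumr !big_seq; apply: ler_sum => t t_supp.
have [h [i [s [s_supp tE]]]] := supp _ _ t_supp.
rewrite [in leLHS]tE; apply: le_trans (psiU _ _ _ _) _; rewrite -tE mulrC.
apply: ler_wpM2r; first by rewrite ler0q.
apply: le_trans (cB _ _ _ s_supp) (ltW (archi_boundP _)).
by do 2!(apply: sumr_ge0 => ? _).
Qed.

End Subgroup.
End Seminorms.

(** * Homotopy equivalence of resolutions and canonical fillings *)

Section Resolutions.
Context (A : nzRingType) (X : lmodType A).

Definition proj_upto (C : augcomplex X) m :=
  forall i, (i <= m)%N -> projective (term C i).

Lemma resolutions_equivalence (C D : augcomplex X) n :
  proj_upto C n.+1 -> proj_upto D n.+1 ->
  exact_upto C n.+1 -> exact_upto D n.+1 ->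
  exists (f0 : {linear term C n -> term D n})
         (f1 : {linear term C n.+1 -> term D n.+1})
         (g0 : {linear term D n -> term C n})
         (g1 : {linear term D n.+1 -> term C n.+1})
         (h : {linear term C n -> term C n.+1}),
    [/\ forall x, bd D n (f1 x) = f0 (bd C n x),
        forall y, bd C n (g1 y) = g0 (bd D n y) &
        forall x, cycles C n x -> x - g0 (f0 x) = bd C n (h x)].
Proof.
move=> prC prD exC exD.
have [f [f0E fS]] := chain_map_exists prC exC exD.
have [g [g0E gS]] := chain_map_exists prD exD exC.
pose u i : {linear term C i -> term C i} := idfun \- (g i \o f i).
have [|i x lt|h hE] :=
    homotopy_exists (u := u) prC exC exC _ _ (ltnSn n).
- by move=> x; rewrite /u /= linearB g0E f0E subrr.
- by rewrite /u /= linearB gS // fS.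
exists (f n), (f n.+1), (g n), (g n.+1), h; split=> [x|y|x xC].
- exact: fS.
- exact: gS.
- exact: hE.
Qed.

(* If the resolution has length n + 1, the boundaries in degree n have canonical
   preimages: this says that the module of n-cycles is projective, without
   having to introduce it as a module. *)
Lemma boundary_retraction (P L : augcomplex X) n :
  projres_length L n.+1 -> proj_upto P n.+1 -> exact_upto P n.+1 ->
  exists e : {linear term P n.+1 -> term P n.+1},
    (forall x, bd P n (e x) = bd P n x) /\
    forall x, bd P n x = 0 -> e x = 0.
Proof.
move=> [exL prL L0] prP exP.
have prL' : proj_upto L n.+1 by move=> i _; exact: prL.
have [f0 [f1 [g0 [g1 [h [fE gE hE]]]]]] :=
  resolutions_equivalence prP prL' exP (exL _).
(* Applying d to g1 f1 gives g0 f0 d, and the homotopy term supplies the difference from d. *)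
exists ((g1 \o f1) \+ (h \o bd P n)); split=> x /=.
  rewrite linearD -hE; last by apply: (bd_cycles exP); exact: ltnSn.
  by rewrite gE fE addrC subrK.
move=> x0; rewrite x0 linear0 addr0.
have : cycles L n.+1 (f1 x) by rewrite /= fE x0 linear0.
(* [f1 x] is a cycle of [L] in degree n + 1, hence the boundary of an element of the zero module in
   degree n + 2. *)
rewrite (exL n.+2).2 // => -[y _ <-].
by rewrite (L0 n.+2 (ltnSn _) y) !linear0.
Qed.

End Resolutions.

(** * Common denominators and integral parts *)

Section Denominators.
Context (Q : {pred rat}) (R : subNzRingType Q) (G : groupType).

Lemma subring_denominator (r : R) :
  exists (N : nat) (z : int), (0 < N)%N /\ r *+ N = z%:~R.
Proof.
exists `|denq (val r)|%N, (numq (val r)); split.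
  by rewrite absz_gt0 denq_neq0.
apply: val_inj; rewrite raddfMn rmorph_int numqE -mulr_natr.
by rewrite natr_absz gtr0_norm ?denq_gt0.
Qed.

Section Submodule.
Context (P : lmodType (grpring R G)) (B : set P).
Context (BZ : ZG_submodule B).

Let B_Mn x N : B x -> B (x *+ N).
Proof.
case: BZ => B0 BD _ Bx; elim: N => [|N IHN]; first by rewrite mulr0n.
by rewrite mulrS; exact: BD.
Qed.

(** The span consists of finite sums of terms r t b with b in [B]. A denominator of r moves such a
    term into [B], and products of denominators deal with sums. *)
Lemma lspan_multiple x : lspan B x -> exists2 N, (0 < N)%N & B (x *+ N).
Proof.
have [B0 BD Bscale] := BZ.
pose good y := exists2 N, (0 < N)%N & B (y *+ N).
have good_sum (I : Type) (s : seq I) (F : I -> P) :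
    (forall i, good (F i)) -> good (\sum_(i <- s) F i).
  move=> goodF; apply: big_ind => //; first by exists 1%N.
  move=> y z [N1 N1_gt0 By] [N2 N2_gt0 Bz].
  exists (N1 * N2)%N; first by rewrite muln_gt0 N1_gt0.
  rewrite mulrnDl; apply: BD; first by rewrite mulrnA; exact: B_Mn.
  by rewrite mulnC mulrnA; exact: B_Mn.
move=> [m [c [e [Be ->]]]]; apply: (good_sum) => i.
rewrite (gr_monomialE (c i)) scaler_suml; apply: good_sum => t.
have [N [z [N_gt0 NE]]] := subring_denominator (c i)@_t.
exists N => //.
have -> : (<< (c i)@_t *g t >> : grpring R G) *: e i *+ N =
    gr_of_int R << z *g t >> *: e i.
  rewrite scalerMnl; congr (_ *: _).
  rewrite gr_of_intU -NE; apply/malgP => g.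
  by rewrite mcoeffMn !mcoeffU mulrnAC.
exact: Bscale.
Qed.

Lemma lspan_common_multiple m (F : 'I_m -> P) :
  (forall i, lspan B (F i)) ->
  exists2 N, (0 < N)%N & forall i, B (F i *+ N).
Proof.
move=> BF; have /choice[N NP] i : exists N, (0 < N)%N /\ B (F i *+ N).
  by have [N] := lspan_multiple (BF i); exists N.
exists (\prod_i N i)%N; first by apply: prodn_gt0 => i; case: (NP i).
move=> i; rewrite (bigD1 i) //= mulrnA; apply: B_Mn.
by case: (NP i).
Qed.

End Submodule.
End Denominators.

(** * Transfer of fillings between G and H, and the theorem *)

Lemma l1_seminormMn (K : realType) (Q : {pred rat}) (R : subNzRingType Q)
    (G : groupType) (M : lmodType (grpring R G)) (N : M -> K) x n :
  l1_seminorm N -> N (x *+ n) <= n%:R * N x.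
Proof.
move=> sN; have [N0 ND NZ] := sN; elim: n => [|n IHn].
  by have := NZ 0 0; rewrite mulr0n scale0r gr_l1_0 rmorph0 !mul0r.
by rewrite mulrS; apply: le_trans (ND _ _) _; rewrite mulrS mulrDl mul1r lerD2l.
Qed.

(** A pointwise comparison between real numbers: the last bound holds for every filling [mu] of [z],
    so that infimum and supremum can be taken afterwards. *)
Lemma filling_function_transfer (K : realType) (Q : {pred rat})
    (R : subNzRingType Q) (n : nat) (G : groupType) (SH : {pred G})
    (H : subGroupType SH) (DH : filling_data K R H n)
    (DG : filling_data K R G n) :
  (exists L : augcomplex (trivmod R G), projres_length L n.+1) ->
  exists C : nat, forall y, fd_int DH y ->
    exists (c : K) (z : term (fd_res DG) n),
      [/\ (bd_norm y <= c%:E)%E, fd_int DG z,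
          fd_norm DG z <= C%:R * fd_norm DH y &
          forall mu, bd (fd_res DG) n mu = z ->
            c <= C%:R * fd_norm1 DG mu + C%:R * fd_norm DH y].
Proof.
move=> [L LP].
pose P := fd_res DG; pose Y := fd_res DH.
have [exP prfgP] := fd_resP DG; have [exY prfgY] := fd_resP DH.
have prP : proj_upto P n.+1 by move=> i /prfgP[].
have prY : proj_upto Y n.+1 by move=> i /prfgY[].
pose rP := res_complex H P.
have prrP : proj_upto rP n.+1.
  by move=> i /prfgP[? ?]; exact: res_projective.
have exrP : exact_upto rP n.+1 by exact: res_exact.
have [e [eE e0]] := boundary_retraction LP prP exP.
have [f0 [f1 [g0 [g1 [h [fE gE hE]]]]]] :=
  resolutions_equivalence prY prrP exY exrP.
have sH1 := filling_seminorm (fd_norm1P DH).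
have sG := filling_seminorm (fd_normP DG).
have [sH1_0 sH1_D _] := sH1.
have [m [rho [rhoS _ _]]] := filling_normP (fd_norm1P DG).
(* Embedding P_(n+1) in a free module gives its elements coefficients, hence supports, and a norm
   that does not decrease under multiples. *)
have [iota iotaK] := projective_section (prP n.+1 (leqnn _)) rhoS.
pose res := resscal (@gr_incl R G SH H).
pose theta : {linear term Y n.+1 -> res 'rV[grpring R G]_m} :=
  res_map (phi := @gr_incl R G SH H) iota \o
    (res_map (phi := @gr_incl R G SH H) e \o f1).
pose psi : {linear res 'rV[grpring R G]_m -> term Y n.+1} :=
  g1 \o res_map (phi := @gr_incl R G SH H) rho.
have [C1 C1P] :=
  bounded_on_fin_gen_image theta psi (prfgY n.+1 (leqnn _)).2 sH1.
have [C2 C2P] :=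
  bounded_filling (iota \o e) (fd_norm1P DG) (@free_norm_seminorm K Q R G m).
have [C3 C3P] := bounded_filling h (fd_normP DH) sH1.
have [C4 C4P] := bounded_filling f0 (fd_normP DH) (res_seminorm H sG).
have [KH_Z BH_Z [p [a [KHa aP]]] BHspan] := fd_intP DH.
have [KG_Z BG_Z _ BGspan] := fd_intP DG.
have cycY y : fd_int DH y -> exists v, bd Y n v = y.
  by move=> /KH_Z; rewrite exY.2 // => -[v _ vy]; exists v.
(* One [N] suffices since the integral part of H has finitely many generators; [f0] maps each to a
   cycle, which lies in the span of the integral part of G. *)
have [|N N_gt0 NP] := lspan_common_multiple BG_Z (F := fun i => f0 (a i)).
  move=> i; rewrite BGspan; have [v <-] := cycY _ (KHa i).
  by rewrite -fE; apply: (bd_cycles exP); exact: ltnSn.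
have f0int y : fd_int DH y -> fd_int DG (f0 y *+ N).
  move=> /aP[c ->].
  have -> : f0 (\sum_i gr_of_int R (c i) *: a i) *+ N =
      \sum_i gr_of_int R (gr_incl (c i)) *: (f0 (a i) *+ N : term P n).
    rewrite linear_sum -sumrMnl; apply: eq_bigr => i _.
    rewrite linearZ /=.
    transitivity
      (gr_incl (gr_of_int R (c i)) *: (f0 (a i) : term P n) *+ N) => //.
    by rewrite gr_incl_of_int scalerMnr.
  have [B0 BD BZ] := BG_Z.
  apply: (big_ind (fd_int DG)) => // i _; exact: BZ (NP i).
(* The summands serve, in order, for [g1 w], for [h y], and for the norm of [f0 y *+ N]. *)
exists (C1 * C2 + C3 + N * C4)%N => y yH.
have [v vy] := cycY _ yH.
have sH_ge0 : 0 <= fd_norm DH y.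
  by case: (filling_seminorm (fd_normP DH)) => + _ _; apply.
have sG1_ge0 x : 0 <= fd_norm1 DG x.
  by case: (filling_seminorm (fd_norm1P DG)) => + _ _; apply.
pose w : term P n.+1 := e (f1 v).
exists (fd_norm1 DH (g1 w + h y)), (f0 y *+ N); split.
- apply: ereal_inf_lbound; exists (g1 w + h y) => //=.
  rewrite linearD gE -hE; last exact: KH_Z.
  have -> : bd rP n w = f0 y by rewrite -vy -fE; exact: eE.
  by rewrite addrC subrK.
- exact: f0int.
- apply: le_trans (l1_seminormMn _ _ sG) _.
  apply: (le_trans (ler_wpM2l _ (C4P y))) => //.
  by rewrite mulrA -natrM ler_wpM2r // ler_nat leq_addl.
- move=> mu muE.
  (* [mu] and [f1 v *+ N] have the same boundary, so [e] does not distinguish them. *)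
  have emu : e mu = w *+ N.
    apply/eqP; rewrite -subr_eq0 /w -(raddfMn e) -linearB; apply/eqP.
    apply: e0; rewrite linearB muE raddfMn.
    apply/eqP; rewrite subr_eq0; apply/eqP; congr (_ *+ _).
    by rewrite -vy; exact/esym/fE.
  have le_w : free_norm K (iota w) <= C2%:R * fd_norm1 DG mu.
    apply: le_trans (C2P mu); rewrite /= emu raddfMn ler_rat.
    exact: free_l1Mn_ge.
  apply: le_trans (sH1_D _ _) _; rewrite -/w.
  have -> : g1 w = psi (theta v) by rewrite /= [rho _]iotaK.
  apply: le_trans (lerD (C1P v) (C3P y)) _; apply: lerD; last first.
    by rewrite ler_wpM2r // ler_nat -addnA addnCA leq_addr.
  apply: le_trans (ler_wpM2l _ le_w) _ => //.
  by rewrite mulrA -natrM ler_wpM2r // ler_nat -addnA leq_addr.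
Qed.

Local Close Scope classical_set_scope.
Local Close Scope ring_scope.

Theorem theorem1p7 (K : realType) (Q : {pred rat}) (R : subNzRingType Q)
    (n : nat) (hn : (1 <= n)%N)
    (G : groupType) (hG : type_FP R G n.+1) (hcd : cd_eq R G n.+1)
    (SH : {pred G}) (H : subGroupType SH) (hH : type_FP R H n.+1)
    (DH : filling_data K R H n) (DG : filling_data K R G n) :
  preceq (FV DH) (FV DG).
Proof.
have [C CP] := filling_function_transfer DH DG hcd.1.
(* The successor is positive, as [preceq] demands and as the division below needs. *)
exists C.+1; split=> // k.
set RHS := (X in (_ <= X)%E).
have FV_ge0 : (0 <= FV DG (C.+1 * k + C.+1))%E by rewrite le_max lexx.
(* The first case is the value 0 built into [FV] for an empty supremum. *)
rewrite ge_max; apply/andP; split.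
  by rewrite /RHS adde_ge0 // ?mule_ge0 // lee_fin ler0n.
apply: ge_ereal_sup => _ [y [yH yk] <-].
have [c [z [le_c zG le_z cP]]] := CP y yH.
apply: (le_trans le_c).
have kC : (C%:R * fd_norm DH y <= (C.+1 * k + C.+1)%:R :> K)%R.
  apply: (le_trans (ler_wpM2l _ yk)) => //.
  rewrite -natrM ler_nat (leq_trans _ (leq_addr _ _)) //.
  by rewrite leq_mul2r leqnSn orbT.
have le_bd : (bd_norm z <= FV DG (C.+1 * k + C.+1))%E.
  rewrite le_max; apply/orP; right; apply: ereal_sup_ubound.
  by exists z => //; split=> //=; exact: le_trans kC.
(* Solving the bound on [c] for the norm of [mu] leaves a constant below every filling norm, hence
   below the infimum. *)
have bd_ge : (((c - (C.+1 * k + C.+1)%:R) / C.+1%:R)%:E <= bd_norm z)%E.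
  apply: le_ereal_inf_tmp => _ [mu muz <-].
  rewrite lee_fin ler_pdivrMr ?ltr0n // lerBlDr.
  apply: (le_trans (cP mu muz)); apply: lerD => //.
  rewrite mulrC ler_wpM2l ?ler_nat //.
  by case: (filling_seminorm (fd_norm1P DG)) => + _ _; apply.
have -> : c = (C.+1%:R * ((c - (C.+1 * k + C.+1)%:R) / C.+1%:R) +
    (C.+1 * k + C.+1)%:R)%R.
  by rewrite mulrC divfK ?pnatr_eq0 // subrK.
rewrite EFinD EFinM; apply: leeD => //.
by apply: lee_wpmul2l; [rewrite lee_fin ler0n|exact: le_trans le_bd].
Qed.
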